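(* Let $0<p,r<\infty$, let $f$ be a measurable function on $\mathbb R$ and let $A>0$. The following are equivalent (up to constants depending only on $p$ and $r$): (i) $\|f\|_{p,\infty}\le A$; (ii) for any set $E$ of finite measure there exists a major subset $\tilde E\subseteq E$ such that $\|f\cdot\mathbf 1_{\tilde E}\|_r\lesssim A\cdot|E|^{\frac1r-\frac1p}$. That is, (i) implies (ii) with an implicit constant depending only on $p,r$, and (ii) implies $\|f\|_{p,\infty}\lesssim A$. Equivalently, $$\|f\|_{p,\infty}\sim\sup_{0<|E|<\infty}\ \inf_{\substack{\tilde E\subseteq E\\ \text{major subset}}}\frac{\|f\cdot\mathbf 1_{\tilde E}\|_r}{|E|^{\frac1r-\frac1p}} .$$
   Context: A measurable subset $\tilde E\subseteq E$ is called a major subset of $E$ if $|\tilde E|\ge|E|/2$. The weak-$L^p$ quasinorm is $\|f\|_{p,\infty}=\sup_{\lambda>0}\lambda\,|\{x:|f(x)|>\lambda\}|^{1/p}$, and $\|f\|_r=(\int|f|^r)^{1/r}$ also for $r<1$. *)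

(* Defs.v *)
From HB Require Import structures.
From mathcomp Require Import all_boot all_order all_algebra.
From mathcomp Require Import all_classical all_reals all_analysis.
From mathcomp Require Import complex.

Set Implicit Arguments.
Unset Strict Implicit.
Unset Printing Implicit Defensive.

Import Order.TTheory GRing.Theory Num.Theory.
Import numFieldNormedType.Exports.

Local Open Scope classical_set_scope.
Local Open Scope ring_scope.
Local Open Scope complex_scope.
Local Open Scope ereal_scope.

(* The real line with the sigma-algebra of all Lebesgue-measurable sets (not
   only the Borel sets); this is the domain of completed_lebesgue_measure. *)
Definition lebesgueR (R : realType) : measurableType _ :=
  caratheodory_type (@wlength R idfun)^*%mu.

Definition lebesgue (R : realType) : {measure set (lebesgueR R) -> \bar R} :=
  @completed_lebesgue_measure R.

Section WeakLp.
Context {d : measure_display} {T : measurableType d} {R : realType}.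
Variable mu : {measure set T -> \bar R}.
Implicit Types (E F : set T) (f : T -> R[i]) (p r A : R).

Definition cmeasurable f : Prop :=
  measurable_fun [set: T] (fun x => complex.Re (f x)) /\
  measurable_fun [set: T] (fun x => complex.Im (f x)).

(* The modulus with values in R; `|z| on R[i] has values in R[i]. *)
Definition cabs (z : R[i]) : R := complex.Re `|z|%R.

Definition weak_Lnorm p f : \bar R :=
  ereal_sup [set l%:E * mu [set x | (l < cabs (f x))%R] `^ p^-1
            | l in [set l : R | (0 < l)%R]].

Definition cLnorm r f : \bar R := Lnorm mu r%:E (fun x => (cabs (f x))%:E).

Definition restr f F : T -> R[i] := fun x => (f x * (\1_F x : R)%:C)%R.

Definition major_subset E F : Prop :=
  [/\ measurable F, F `<=` E & mu E / 2%:E <= mu F].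

(* If mu E = 0 and r^-1 < p^-1, the library's convention 0 `^ a = 0 applies;
   this is harmless, as the left-hand side vanishes for such E. *)
Definition major_subset_bound p r f A : Prop :=
  forall E, measurable E -> mu E < +oo ->
    exists2 F, major_subset E F &
      cLnorm r (restr f F) <= A%:E * mu E `^ (r^-1 - p^-1).

Definition major_subset_norm p r f : \bar R :=
  ereal_sup
    [set ereal_inf [set cLnorm r (restr f F) / mu E `^ (r^-1 - p^-1)
                   | F in major_subset E]
    | E in [set E | measurable E /\ 0 < mu E < +oo]].

End WeakLp.

(* Main.v *)
Require Import Defs.
From HB Require Import structures.
From mathcomp Require Import all_boot all_order all_algebra.
From mathcomp Require Import all_classical all_reals all_analysis.
From mathcomp Require Import complex measurable_realfun.
Import Order.TTheory GRing.Theory Num.Theory.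

(** Both implications come from comparing the L^r norm of [f] on a set where
    [|f|] is bounded above, resp. below, by a constant [l], with [l] times the
    measure of that set to the power [1/r] ([cLnorm_restr_le],
    [cLnorm_restr_ge]).

    If [f] has weak norm at most [A] and [E] has finite positive measure, the
    level [l = A (2/|E|)^(1/p)] is such that [|f| > l] only on a set of measure
    at most [|E|/2].  Removing that set from [E] leaves a major subset on which
    [|f| <= l], so the L^r norm there is at most
    [l |E|^(1/r) = 2^(1/p) A |E|^(1/r-1/p)].

    Conversely, test the hypothesis on a set [E] of finite measure on which
    [|f| > l].  Its major subset [F] satisfies
    [l (|E|/2)^(1/r) <= l |F|^(1/r) <= A |E|^(1/r-1/p)], that is,
    [l |E|^(1/p) <= 2^(1/r) A].  Since the measure is sigma-finite, the whole
    set where [|f| > l] is an increasing union of such [E], and the bound passes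
    to the limit.

    The two-sided comparison of the weak norm with the sup-inf expression is the
    same pair of implications, read for every admissible [A] and optimised in
    [A] ([lee_mul_density]).  The infimum over major subsets need not be
    attained, which is why it is compared with [A] strictly in one direction.
    Lebesgue measure enters through sigma-finiteness and the existence of a set
    of finite positive measure. *)

Local Open Scope classical_set_scope.
Local Open Scope ring_scope.
Local Open Scope complex_scope.

(** * The modulus and its level sets *)

Lemma cabsE (R : realType) (z : R[i]) :
  cabs z = Num.sqrt (complex.Re z ^+ 2 + complex.Im z ^+ 2).
Proof. by rewrite /cabs normc_def. Qed.

Lemma cabs_ge0 (R : realType) (z : R[i]) : 0 <= cabs z.
Proof. by rewrite cabsE sqrtr_ge0. Qed.

Lemma measurable_cabs d (T : measurableType d) (R : realType) (f : T -> R[i]) :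
  cmeasurable f -> measurable_fun [set: T] (fun x => cabs (f x)).
Proof.
move=> [mre mim].
have -> : (fun x => cabs (f x)) = (fun y : R => y `^ 2^-1) \o
    (fun x => complex.Re (f x) ^+ 2 + complex.Im (f x) ^+ 2).
  apply/funext => x /=.
  by rewrite cabsE powR12_sqrt// addr_ge0// sqr_ge0.
apply: measurableT_comp; first exact: measurable_powR.
by apply: measurable_funD; apply: measurable_funX.
Qed.

Lemma measurable_cabs_gt d (T : measurableType d) (R : realType)
    (f : T -> R[i]) (l : R) :
  cmeasurable f -> measurable [set x | l < cabs (f x)].
Proof.
move=> /measurable_cabs mf.
rewrite -[X in measurable X]setTI.
have := measurable_fun_ltr (measurable_cst l) mf.
by move=> /(_ measurableT [set true]); apply.
Qed.

(** * L^r norms on sets where the modulus is bounded *)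

Lemma cLnorm_restrE d (T : measurableType d) (R : realType)
    (mu : {measure set T -> \bar R}) (r : R) (f : T -> R[i]) (F : set T) :
  0 < r ->
  cLnorm mu r (restr f F) =
    ((\int[mu]_(x in F) (cabs (f x) `^ r)%:E) `^ r^-1)%E.
Proof.
move=> r0; rewrite /cLnorm unlock; congr (_ `^ _)%E.
rewrite [RHS]integral_mkcond; apply: eq_integral => x _.
rewrite /patch /restr indicE.
case: ifPn => _; rewrite ?mulr1 ?mulr0 /=.
  by rewrite ger0_norm ?cabs_ge0.
by rewrite /cabs normr0 /= normr0 powR0 ?gt_eqF.
Qed.

Lemma lee_poweR (R : realType) (q : R) (x y : \bar R) :
  0 <= q -> (0 <= x)%E -> (x <= y)%E -> (x `^ q <= y `^ q)%E.
Proof.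
move=> q0 x0 xy; apply: gt0_ler_poweR => //; rewrite in_itv /= leey andbT//.
exact: le_trans xy.
Qed.

Section CLnorm.
Context d (T : measurableType d) (R : realType).
Variable mu : {measure set T -> \bar R}.
Implicit Types (r l : R) (f : T -> R[i]) (F : set T).

Let measurable_cabs_powR r f F : cmeasurable f ->
  measurable_fun F (fun x => (cabs (f x) `^ r)%:E).
Proof.
move=> mf; apply/measurable_EFinP; apply/measurable_funTS.
apply: (measurableT_comp (measurable_powR _)).
exact: measurable_cabs.
Qed.

Let poweR_integral_cst r l F : measurable F -> 0 < r -> 0 <= l ->
  ((\int[mu]_(x in F) (cst (l `^ r)%:E x)) `^ r^-1 = l%:E * mu F `^ r^-1)%E.
Proof.
move=> mF r0 l0; rewrite integral_cst// poweRM ?lee_fin ?powR_ge0//.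
by rewrite poweR_EFin -powRrM divff ?gt_eqF// powRr1.
Qed.

Lemma cLnorm_restr_le r l f F : 0 < r -> 0 <= l ->
  cmeasurable f -> measurable F -> (forall x, F x -> cabs (f x) <= l) ->
  (cLnorm mu r (restr f F) <= l%:E * mu F `^ r^-1)%E.
Proof.
move=> r0 l0 mf mF fl; rewrite cLnorm_restrE// -poweR_integral_cst//.
apply: lee_poweR; first by rewrite invr_ge0 ltW.
  by apply: integral_ge0 => x _; rewrite lee_fin powR_ge0.
apply: ge0_le_integral => //.
- by move=> x _; rewrite lee_fin powR_ge0.
- exact: measurable_cabs_powR.
- by move=> x Fx; rewrite lee_fin ge0_ler_powR ?nnegrE ?cabs_ge0 ?fl// ltW.
Qed.

Lemma cLnorm_restr_ge r l f F : 0 < r -> 0 <= l ->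
  cmeasurable f -> measurable F -> (forall x, F x -> l <= cabs (f x)) ->
  (l%:E * mu F `^ r^-1 <= cLnorm mu r (restr f F))%E.
Proof.
move=> r0 l0 mf mF fl; rewrite cLnorm_restrE// -poweR_integral_cst//.
apply: lee_poweR; first by rewrite invr_ge0 ltW.
  by apply: integral_ge0 => x _; rewrite lee_fin powR_ge0.
apply: ge0_le_integral => //.
- by move=> x _; rewrite lee_fin powR_ge0.
- exact: measurable_cabs_powR.
- by move=> x Fx; rewrite lee_fin ge0_ler_powR ?nnegrE ?cabs_ge0 ?fl// ltW.
Qed.

(** On a null set the factor [mu E `^ (r^-1 - p^-1)] carries no information, so
    such sets are settled by the vanishing of the norm rather than by the
    choice of a level. *)
Lemma cLnorm_restr_null r f F : 0 < r -> cmeasurable f -> measurable F ->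
  mu F = 0%E -> cLnorm mu r (restr f F) = 0%E.
Proof.
move=> r0 mf mF F0; rewrite cLnorm_restrE// null_set_integral//.
  by rewrite poweR0r// invr_neq0// gt_eqF.
exact: measurable_cabs_powR.
Qed.

End CLnorm.

(** * Arithmetic of powers and extended reals *)

Lemma powRVl (R : realType) (x q : R) : 0 <= x -> x^-1 `^ q = x `^ (- q).
Proof. by move=> x0; rewrite -powR_inv1// -powRrM mulN1r. Qed.

(** Solves a weak-type inequality for the measure of the level set, which, unlike
    its power, can be subtracted from the measure of [E] in one implication and
    is directly subject to continuity from below in the other. *)
Lemma lee_mul_poweR (R : realType) (p l M : R) (x : \bar R) :
  0 < p -> 0 < l -> 0 <= M -> (0 <= x)%E ->
  (l%:E * x `^ p^-1 <= M%:E)%E = (x <= ((M / l) `^ p)%:E)%E.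
Proof.
move=> p0 l0 M0; case: x => [x||//]; last first.
  by rewrite /= invr_eq0 gt_eqF// gt0_muley ?lte_fin.
rewrite !lee_fin => x0; rewrite mulrC -ler_pdivlMr//.
have Ml0 : 0 <= M / l by rewrite divr_ge0// ltW.
apply/idP/idP => [|h].
  move=> /(ge0_ler_powR (ltW p0)); rewrite !nnegrE powR_ge0 => /(_ isT Ml0).
  by rewrite -powRrM mulVf ?gt_eqF// powRr1.
have -> : M / l = ((M / l) `^ p) `^ p^-1.
  by rewrite -powRrM divff ?gt_eqF// powRr1.
by rewrite ge0_ler_powR ?nnegrE ?powR_ge0 ?invr_ge0 ?(ltW p0).
Qed.

(** Replaces bounds by every real [A > y] with a bound by [y], which may be
    infinite or zero; positivity of [A] is required because both implications
    are proved for positive constants only. *)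
Lemma lee_mul_density (R : realType) (C : R) (x y : \bar R) :
  0 < C -> (0 <= y)%E ->
  (forall A : R, 0 < A -> (y < A%:E)%E -> (x <= (C * A)%:E)%E) ->
  (x <= C%:E * y)%E.
Proof.
move=> C0; case: y => [y y0|_ _|//]; last by rewrite gt0_muley ?lte_fin// leey.
move=> h; apply/lee_addgt0Pr => e e0.
have eC : 0 < e / C by rewrite divr_gt0.
have := h (y + e / C); rewrite lte_fin ltrDl => /(_ _ eC).
rewrite mulrDr mulrCA divff ?gt_eqF// mulr1; apply.
by rewrite ltr_wpDl.
Qed.

(** * The two implications and the sup-inf norm *)

Section Equivalence.
Context d (T : measurableType d) (R : realType).
Variable mu : {measure set T -> \bar R}.
Variables (p r : R).
Hypotheses (p0 : 0 < p) (r0 : 0 < r).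
Implicit Types (A l : R) (f : T -> R[i]) (E F : set T).

Lemma weak_Lnorm_ge0 f : (0 <= weak_Lnorm mu p f)%E.
Proof.
apply: (@le_trans _ _ (1%:E * mu [set x | (1 < cabs (f x))%R] `^ p^-1)%E).
  by rewrite mule_ge0 ?lee_fin ?poweR_ge0.
by apply: ereal_sup_ubound; exists 1 => //=.
Qed.

Lemma weak_Lnorm_leP f A : 0 <= A ->
  (weak_Lnorm mu p f <= A%:E)%E <->
  (forall l, 0 < l -> (mu [set x | (l < cabs (f x))%R] <= ((A / l) `^ p)%:E)%E).
Proof.
move=> A0; split=> [fA l l0|h].
  rewrite -lee_mul_poweR//; apply: le_trans fA.
  by apply: ereal_sup_ubound; exists l.
apply: ge_ereal_sup => _ [l /= l0 <-].
by rewrite lee_mul_poweR// h.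
Qed.

(** The part of [E] where [|f|] exceeds a level is discarded, the level being
    the smallest for which the weak-type bound guarantees that at most half of [E]
    is lost. *)
Lemma weak_Lnorm_major_subset_bound f A : cmeasurable f -> 0 < A ->
  (weak_Lnorm mu p f <= A%:E)%E -> major_subset_bound mu p r f (2 `^ p^-1 * A).
Proof.
move=> mf A0 /(weak_Lnorm_leP _ _ (ltW A0)) fA E mE Efin.
have Enum : mu E \is a fin_num by rewrite ge0_fin_numE.
have [E0|E0] := eqVneq (mu E) 0%E.
  exists E; first by split=> //; rewrite E0 mul0e.
  rewrite cLnorm_restr_null// mule_ge0 ?poweR_ge0// lee_fin.
  by rewrite mulr_ge0 ?powR_ge0// ltW.
set s := fine (mu E); have sE : mu E = s%:E by rewrite /s fineK.
have s0 : 0 < s by rewrite -lte_fin -sE lt_neqAle eq_sym E0 /=.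
(* The solution of [(A / l)^p = s / 2]. *)
pose l := A * (2 / s) `^ p^-1.
have l0 : 0 < l by rewrite mulr_gt0// powR_gt0// divr_gt0.
have mB := measurable_cabs_gt _ _ _ f l mf.
set B := [set x | _] in mB.
have AlE : (A / l) `^ p = s / 2.
  rewrite /l invfM mulrA divff ?gt_eqF// mul1r -powRN -powRrM mulNr.
  rewrite mulVf ?gt_eqF//.
  by rewrite powR_inv1 ?invf_div// divr_ge0// ltW.
have Bs : (mu (E `&` B) <= (s / 2)%:E)%E.
  rewrite -AlE; apply: le_trans (fA l l0).
  by apply: le_measure; rewrite ?inE//; exact: measurableI.
have mF : measurable (E `\` B) by exact: measurableD.
have FE : (mu (E `\` B) <= s%:E)%E.
  by rewrite -sE; apply: le_measure; rewrite ?inE//; exact: subDsetl.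
exists (E `\` B).
  split=> //; rewrite sE inver pnatr_eq0 /=.
  have -> : mu (E `\` B) = (mu E - mu (E `&` B))%E by exact: measureD.
  rewrite sE leeBrDr; last first.
    by rewrite ge0_fin_numE// (le_lt_trans Bs)// ltry.
  apply: (@le_trans _ _ ((s / 2)%:E + (s / 2)%:E)%E); first by rewrite leeD2l.
  by rewrite -EFinD -splitr.
apply: (@le_trans _ _ (l%:E * mu (E `\` B) `^ r^-1)%E).
  apply: cLnorm_restr_le => //; first exact: ltW.
  by move=> x [_ /= /negP]; rewrite -leNgt.
apply: (@le_trans _ _ (l%:E * s%:E `^ r^-1)%E).
  rewrite lee_wpmul2l ?lee_fin ?(ltW l0)//.
  by apply: lee_poweR; rewrite ?invr_ge0 ?(ltW r0).
rewrite sE !poweR_EFin -!EFinM lee_fin.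
rewrite /l powRM ?invr_ge0 ?(ltW s0)// powRVl ?(ltW s0)//.
rewrite (mulrC A) -!mulrA ler_wpM2l ?powR_ge0//.
rewrite mulrCA ler_wpM2l ?(ltW A0)// -powRD.
  by rewrite addrC.
by rewrite (gt_eqF s0) implybT.
Qed.

(** A level set may have infinite measure, so the hypothesis is tested on its
    intersections with an exhausting sequence [G n] of sets of finite
    measure, with a bound that does not depend on [n]. *)
Lemma major_subset_bound_weak_Lnorm f A : sigma_finite [set: T] mu ->
  cmeasurable f -> 0 < A ->
  major_subset_bound mu p r f A -> (weak_Lnorm mu p f <= (2 `^ r^-1 * A)%:E)%E.
Proof.
move=> /sigma_finiteP[G [GT ndG Gfin]] mf A0 fA.
have M0 : 0 <= 2 `^ r^-1 * A by rewrite mulr_ge0 ?powR_ge0// ltW.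
apply/weak_Lnorm_leP => // l l0.
have mB := measurable_cabs_gt _ _ _ f l mf.
set B := [set x | _] in mB *.
have BG : B = (\bigcup_n (B `&` G n))%classic.
  by rewrite -setI_bigcupr -GT setIT.
have mBG n : measurable (B `&` G n) by apply: measurableI => //; case: (Gfin n).
have cvgB : (mu (B `&` G n)%classic @[n --> \oo] --> mu B)%classic.
  rewrite [X in mu X]BG; apply: nondecreasing_cvg_mu => //.
    by rewrite -BG.
  by move=> m n mn; apply/subsetPset; apply: setIS; apply/subsetPset/ndG.
rewrite -(cvg_lim _ cvgB)//; apply: lime_le.
  by apply/cvg_ex; exists (mu B).
near=> n.
set E := (B `&` G n)%classic.
have Efin : (mu E < +oo)%E.
  apply: le_lt_trans (Gfin n).2; apply: le_measure; rewrite ?inE.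
  - exact: mBG.
  - by case: (Gfin n).
  - exact: subIsetr.
have Enum : mu E \is a fin_num by rewrite ge0_fin_numE.
rewrite -lee_mul_poweR//.
(* The bound cannot be divided by a power of [mu E] when [mu E = 0]. *)
have [->|E0] := eqVneq (mu E) 0%E.
  by rewrite poweR0r ?mule0// gt_eqF ?invr_gt0.
set s := fine (mu E); have sE : mu E = s%:E by rewrite /s fineK.
have s0 : 0 < s by rewrite -lte_fin -sE lt_neqAle eq_sym E0 /=.
have [F [mF FE EF] fFA] := fA _ (mBG n) Efin.
have fF : (l%:E * mu F `^ r^-1 <= cLnorm mu r (restr f F))%E.
  apply: cLnorm_restr_ge => //; first exact: ltW.
  by move=> x /FE[/ltW].
have : (l%:E * ((s / 2)%:E) `^ r^-1 <= A%:E * mu E `^ (r^-1 - p^-1))%E.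
  apply: le_trans fFA; apply: le_trans fF.
  rewrite lee_wpmul2l ?lee_fin ?(ltW l0)//.
  apply: lee_poweR; first by rewrite invr_ge0 ltW.
    by rewrite lee_fin divr_ge0// ltW.
  by move: EF; rewrite -/E sE inver pnatr_eq0.
rewrite sE !poweR_EFin -!EFinM !lee_fin powRM ?invr_ge0 ?(ltW s0)// powRVl//.
rewrite powRD; last by rewrite (gt_eqF s0) implybT.
rewrite !powRN.
have a0 : 0 < s `^ r^-1 by rewrite powR_gt0.
have b0 : 0 < s `^ p^-1 by rewrite powR_gt0.
have c0 : 0 < 2 `^ r^-1 :> R by rewrite powR_gt0.
move: (s `^ r^-1) (s `^ p^-1) (2 `^ r^-1) a0 b0 c0 => a b c a0 b0 c0.
rewrite mulrCA (mulrCA A) ler_pM2l// -[l * b <= _]ler_pdivrMl//.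
by rewrite ler_pdivlMr// mulrAC mulrC.
Unshelve. all: by end_near.
Qed.

(** Without a set of finite positive measure the supremum would run over the
    empty set and equal [-oo]. *)
Lemma major_subset_norm_ge0 f :
  (exists2 E, measurable E & (0 < mu E < +oo)%E) ->
  (0 <= major_subset_norm mu p r f)%E.
Proof.
move=> [E mE E0]; apply: le_ereal_sup_tmp; exists (ereal_inf
  [set cLnorm mu r (restr f F) / mu E `^ (r^-1 - p^-1)
  | F in major_subset mu E])%E; first by exists E.
apply: le_ereal_inf_tmp => _ [F _ <-].
rewrite mule_ge0// ?inve_ge0 ?poweR_ge0//.
exact: Lnorm_ge0.
Qed.

Lemma major_subset_norm_le f A : 0 < A ->
  major_subset_bound mu p r f A -> (major_subset_norm mu p r f <= A%:E)%E.
Proof.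
move=> A0 fA; apply: ge_ereal_sup => _ [E [mE /andP[E0 Efin]] <-].
have [F EF fF] := fA E mE Efin.
apply: ereal_inf_le; exists (cLnorm mu r (restr f F) / mu E `^ (r^-1 - p^-1))%E.
  by exists F.
have Enum : mu E \is a fin_num by rewrite ge0_fin_numE.
move: E0 fF; rewrite -(fineK Enum) lte_fin => s0.
rewrite poweR_EFin inver gt_eqF ?powR_gt0// => h.
by rewrite lee_pdivrMr// powR_gt0.
Qed.

(** Strictness provides a major subset whose quotient is below [A], even when
    the infimum is not attained. *)
Lemma major_subset_norm_lt_bound f A : cmeasurable f -> 0 < A ->
  (major_subset_norm mu p r f < A%:E)%E -> major_subset_bound mu p r f A.
Proof.
move=> mf A0 fA E mE Efin.
have [E0|E0] := eqVneq (mu E) 0%E.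
  exists E; first by split=> //; rewrite E0 mul0e.
  by rewrite cLnorm_restr_null// mule_ge0 ?poweR_ge0// lee_fin ltW.
have Egt0 : (0 < mu E)%E by rewrite lt_neqAle eq_sym E0 /=.
have Enum : mu E \is a fin_num by rewrite ge0_fin_numE.
have : (ereal_inf [set cLnorm mu r (restr f F) / mu E `^ (r^-1 - p^-1)
    | F in major_subset mu E] < A%:E)%E.
  apply: le_lt_trans fA; apply: ereal_sup_ubound; exists E => //.
  by split=> //; rewrite Egt0.
move=> /ereal_inf_lt[_ [F EF <-]] /ltW h; exists F => //.
move: Egt0 h; rewrite -(fineK Enum) lte_fin => s0.
by rewrite poweR_EFin inver gt_eqF ?powR_gt0// lee_pdivrMr// powR_gt0.
Qed.

End Equivalence.

(** * Lebesgue measure *)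

Lemma sigma_finite_lebesgue (R : realType) :
  sigma_finite [set: lebesgueR R] (lebesgue R).
Proof. exact: sigma_finiteT. Qed.

Lemma lebesgue_itv01 (R : realType) :
  exists2 E : set (lebesgueR R), measurable E & (0 < lebesgue R E < +oo)%E.
Proof.
have m01 : measurable (`]0, 1]%classic : set (ocitv_type R)) by exact: is_ocitv.
exists `]0, 1]%classic.
  by apply: sub_caratheodory; exact: sub_sigma_algebra.
suff -> : lebesgue R `]0, 1]%classic = 1%E by rewrite lte01 ltry.
rewrite /lebesgue /= /completed_lebesgue_measure /=.
rewrite /completed_lebesgue_stieltjes_measure /completed_measure_extension.
rewrite measurable_mu_extE//= wlength_itv_bnd//=.
by rewrite subr0.
Qed.

Theorem proposition8 (R : realType) (p r : R) (hp : 0 < p) (hr : 0 < r) :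
  [/\ (* (i) implies (ii) *)
      exists C : R, 0 < C /\
        forall (f : lebesgueR R -> R[i]) (A : R), cmeasurable f -> 0 < A ->
          (weak_Lnorm (lebesgue R) p f <= A%:E)%E ->
          major_subset_bound (lebesgue R) p r f (C * A),
      (* (ii) with implicit constant C implies (i) up to a constant *)
      forall C : R, 0 < C -> exists C' : R, 0 < C' /\
        forall (f : lebesgueR R -> R[i]) (A : R), cmeasurable f -> 0 < A ->
          major_subset_bound (lebesgue R) p r f (C * A) ->
          (weak_Lnorm (lebesgue R) p f <= (C' * A)%:E)%E &
      exists c C : R, [/\ 0 < c, 0 < C &
        forall f : lebesgueR R -> R[i], cmeasurable f ->
          (c%:E * major_subset_norm (lebesgue R) p r f
             <= weak_Lnorm (lebesgue R) p f
             <= C%:E * major_subset_norm (lebesgue R) p r f)%E]].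
Proof.
have Cp0 : 0 < 2 `^ p^-1 :> R by rewrite powR_gt0.
have Cr0 : 0 < 2 `^ r^-1 :> R by rewrite powR_gt0.
split.
- exists (2 `^ p^-1); split=> // f A mf A0.
  exact: weak_Lnorm_major_subset_bound.
- move=> C C0; exists (2 `^ r^-1 * C); split; first by rewrite mulr_gt0.
  move=> f A mf A0 fA; rewrite -mulrA.
  apply: major_subset_bound_weak_Lnorm => //; last by rewrite mulr_gt0.
  exact: sigma_finite_lebesgue.
- exists (2 `^ p^-1)^-1, (2 `^ r^-1); split; [by rewrite invr_gt0|by []|].
  move=> f mf; apply/andP; split.
    rewrite lee_pdivrMl//; apply: lee_mul_density => //.
      exact: weak_Lnorm_ge0.
    move=> A A0 /ltW fA; apply: major_subset_norm_le => //.
      by rewrite mulr_gt0.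
    exact: weak_Lnorm_major_subset_bound.
  apply: lee_mul_density => //.
    exact/major_subset_norm_ge0/lebesgue_itv01.
  move=> A A0 fA; apply: major_subset_bound_weak_Lnorm => //.
    exact: sigma_finite_lebesgue.
  exact: major_subset_norm_lt_bound.
Qed.
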